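(* Let $f$ and $b$ be real numbers such that $0 < f < b \leq \frac{1+f}{4}$. Let $\pi\colon\mathbb{R}\to\mathbb{R}$ be the function that is periodic modulo $1$ and is given on $[0,1]$ by \[ \pi(x) = \begin{cases} \frac{x}{f} & \text{if } 0 \leq x \leq f, \\ 1 + \frac{(1+f-b)(x-f)}{(1+f)(f-b)} & \text{if } f \leq x \leq b, \\ \frac{x}{1+f} & \text{if } b \leq x \leq 1+f-b, \\ \frac{(1+f-b)(x-1)}{(1+f)(f-b)} & \text{if } 1+f-b \leq x \leq 1. \end{cases} \] Then $\pi$ is an extreme function for the single-row Gomory--Johnson infinite group problem $R_f(\mathbb{R},\mathbb{Z})$.
   Context: Let $f\in\mathbb{R}\setminus\mathbb{Z}$. The single-row infinite group problem concerns functions $y\colon\mathbb{R}\to\mathbb{Z}_+$ (nonnegative integer values) of finite support satisfying $\sum_{r\in\mathbb{R}} r\,y(r)\equiv f \pmod 1$, i.e. $\sum_{r\in\mathbb{R}} r\,y(r) - f\in\mathbb{Z}$. Let $R_f(\mathbb{R},\mathbb{Z})$ denote the convex hull of the set of all such functions $y$ (its elements are functions $\mathbb{R}\to\mathbb{R}_+$). A valid function for $R_f(\mathbb{R},\mathbb{Z})$ is a nonnegative function $\pi\colon\mathbb{R}\to\mathbb{R}$ (that is, $\pi(r)\ge 0$ for all $r$) such that $\sum_{r\in\mathbb{R}}\pi(r)y(r)\ge 1$ for all $y\in R_f(\mathbb{R},\mathbb{Z})$ (equivalently, for all functions $y\colon\mathbb{R}\to\mathbb{Z}_+$ of finite support with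 $\sum_{r} r\,y(r)\equiv f\pmod 1$). A valid function $\pi$ is extreme if it is not a proper convex combination of other valid functions; that is, whenever $\pi=\frac12(\pi^1+\pi^2)$ with $\pi^1,\pi^2$ valid functions, then $\pi=\pi^1=\pi^2$. *)

(* Defs.v *)
From mathcomp Require Import all_boot all_order all_algebra.
From mathcomp Require Import all_classical all_reals.
From mathcomp Require Import topology convex.
From mathcomp Require Import ring lra.

Set Implicit Arguments.
Unset Strict Implicit.
Unset Printing Implicit Defensive.

Import Order.TTheory GRing.Theory Num.Theory.

Local Open Scope classical_set_scope.
Local Open Scope ring_scope.

Definition convex_hull (R : numDomainType) (M : lmodType R) (A : set M) :
    set M :=
  smallest (@convex_set R M) A.

Definition gj_solution (R : realType) (f : R) (y : R -> nat) : Prop :=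
  finite_set [set r | y r != 0%N] /\
  \sum_(r \in [set: R]) r * (y r)%:R - f \is a Num.int.

(* [R -> R^o] is the real vector space of functions from R to R; [R^o] is
   R seen as a module over itself. *)
Definition gj_relaxation (R : realType) (f : R) : set (R -> R^o) :=
  convex_hull [set (fun r => (y r)%:R : R^o) | y in gj_solution f].

Lemma gj_relaxation_finite_support (R : realType) (f : R) (y : R -> R^o) :
  gj_relaxation f y -> finite_set [set r | y r != 0].
Proof.
move=> /(_ [set y | finite_set [set r | y r != 0]]); apply; split.
  move=> y1 y2 l; rewrite !inE /= => fin1 fin2.
  apply: (@sub_finite_set _ _ ([set r | y1 r != 0] `|` [set r | y2 r != 0])).
    move=> r /=; have [y10|] := eqVneq (y1 r) 0; last by left.
    have [y20|] := eqVneq (y2 r) 0; last by right.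
    suff -> : (conv l y1 y2 : R -> R^o) r = 0 by rewrite eqxx.
    by rewrite /conv /= !fctE /= y10 y20 !scaler0 addr0.
  by rewrite finite_setU.
move=> _ [z [finz _] <-] /=; apply: sub_finite_set finz => r /=.
by rewrite pnatr_eq0.
Qed.

(* Elements of [gj_relaxation f] have finite support, so that the sum below is
   never the default value 0 that [\sum_(_ \in _)] takes on infinite supports;
   see [gj_relaxation_finite_support]. *)
Definition valid_function (R : realType) (f : R) (pi : R -> R) : Prop :=
  (forall r, 0 <= pi r) /\
  (forall y, gj_relaxation f y -> 1 <= \sum_(r \in [set: R]) pi r * y r).

Definition extreme_function (R : realType) (f : R) (pi : R -> R) : Prop :=
  valid_function f pi /\
  forall pi1 pi2 : R -> R, valid_function f pi1 -> valid_function f pi2 ->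
    (forall r, pi r = 2^-1 * (pi1 r + pi2 r)) ->
    pi = pi1 /\ pi = pi2.

Definition drlm_backward_3_slope (R : realType) (f b x : R) : R :=
  let t := x - (Num.floor x)%:~R in
  if t <= f then t / f
  else if t <= b then 1 + (1 + f - b) * (t - f) / ((1 + f) * (f - b))
  else if t <= 1 + f - b then t / (1 + f)
  else (1 + f - b) * (t - 1) / ((1 + f) * (f - b)).

Lemma drlm_backward_3_slope_periodic (R : realType) (f b x : R) :
  drlm_backward_3_slope f b (x + 1) = drlm_backward_3_slope f b x.
Proof.
rewrite /drlm_backward_3_slope floorDrz ?rpred1// floor1 intrD.
by have -> : x + 1 - ((Num.floor x)%:~R + 1%:~R) = x - (Num.floor x)%:~R by ring.
Qed.

Lemma drlm_backward_3_slopeE (R : realType) (f b x : R) :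
  0 < f -> f < b -> b <= (1 + f) / 4 -> 0 <= x <= 1 ->
  [/\ x <= f -> drlm_backward_3_slope f b x = x / f,
      f <= x <= b -> drlm_backward_3_slope f b x =
        1 + (1 + f - b) * (x - f) / ((1 + f) * (f - b)),
      b <= x <= 1 + f - b -> drlm_backward_3_slope f b x = x / (1 + f) &
      1 + f - b <= x -> drlm_backward_3_slope f b x =
        (1 + f - b) * (x - 1) / ((1 + f) * (f - b))].
Proof.
move=> f0 fb b4 /andP[x0 x1].
have fn0 : f != 0 by rewrite gt_eqF.
have f1n0 : 1 + f != 0 by rewrite gt_eqF//; lra.
have fbn0 : f - b != 0 by rewrite lt_eqF//; lra.
rewrite /drlm_backward_3_slope; move: x1; rewrite le_eqVlt => /predU1P[->|x1].
  rewrite floor1 subrr (ltW f0).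
  split=> [?|/andP[? ?]|/andP[? ?]|_]; try by exfalso; lra.
  by rewrite mulr0 !mul0r.
have -> : Num.floor x = 0 by apply/eqP; rewrite floor_eq; rewrite x0 add0r.
rewrite subr0; split=> [->//|/andP[fx xb]|/andP[bx xfb]|xfb].
- case: ifPn => [xf|_]; last by rewrite xb.
  have -> : x = f by lra.
  by field; rewrite ?fn0 ?f1n0 ?fbn0.
- rewrite ifF; last by lra.
  case: ifPn => [xb|_]; last by rewrite xfb.
  have -> : x = b by lra.
  by field; rewrite ?fn0 ?f1n0 ?fbn0.
- rewrite ifF; last by lra.
  rewrite ifF; last by lra.
  case: ifPn => [xfb'|//].
  have -> : x = 1 + f - b by lra.
  by field; rewrite ?fn0 ?f1n0 ?fbn0.
Qed.

(* Main.v *)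
Require Import Defs.
From mathcomp Require Import all_boot all_order all_algebra.
From mathcomp Require Import all_classical all_reals.
From mathcomp Require Import interval_inference convex ring lra.

Import Order.TTheory GRing.Theory Num.Theory.

Local Open Scope classical_set_scope.
Local Open Scope ring_scope.

(** Write [p] for the function of the theorem, fix [t] in [[0, 1[] and put
    [q t = (1 + f) * p t - t].  Since the third piece of [p] lies on the line of
    slope [1 / (1 + f)] through the origin, [q] vanishes there; it climbs from 0
    to 1 on [[0, f]], falls back to 0 on [[f, b]], and falls from 0 to -1 on the
    last piece.

    Validity.  If [x + y + z] is [f] modulo 1, their representatives in [[0, 1[]
    add up to [f], [1 + f] or [2 + f], and [p x + p y + p z >= 1] says that the
    three values of [q] add up to at least 1, 0 or -1 respectively.  Each case
    is elementary ([deviation_sum1], [deviation_sum2], [drlm_triple]).  Together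
    with the symmetry [p x + p (f - x) = 1] ([drlm_sym]) this is subadditivity,
    and a subadditive function that is 0 at 0 and 1 on [f + Z] is valid
    ([subadditive_valid]).

    Extremality.  If [p] is the midpoint of two valid functions, every solution
    that is tight for [p] is tight for both of them ([tight_seq]).  Applied to
    solutions with one, two or three entries, this hands over to each summand
    [phi] the value 1 at [f], the symmetry (hence periodicity and the bound
    [phi <= 1]), and every additivity relation [p (x + y) = p x + p y].  As [p]
    is linear near 0 on either side and proportional to [x] on the third piece,
    these relations include Cauchy equations on [[0, f]] and [[f - b, 0]] and a
    Pexider equation on a triangle inside the third piece.  The bounded solutions
    of such equations are linear ([bounded_additive_linear],
    [triangle_additive_linear]); their slopes are pinned down by [phi f = 1], by
    the symmetry, and by the common endpoint of two pieces, and the second piece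
    is the mirror image of the last.  The hypothesis [b <= (1 + f) / 4] is
    exactly what lets the triangle cover the whole third piece. *)

Set Implicit Arguments.
Unset Strict Implicit.
Unset Printing Implicit Defensive.

(** * Solutions as lists *)

Lemma fsum_setT_seq (T : choiceType) (V : nmodType) (s : seq T) (F : T -> V) :
  uniq s -> (forall i, i \notin s -> F i = 0) ->
  \sum_(i \in [set: T]) F i = \sum_(i <- s) F i.
Proof.
move=> us F0; rewrite (@fsbigE _ _ _ _ _ s) //; last by move=> i _; exact: F0.
by apply: eq_bigl => i; rewrite in_setT.
Qed.

(** A solution given by nonnegative integers is a multiset of reals, hence the
    multiplicity function of a list. *)
Lemma sum_count_mem (R : pzRingType) (T : choiceType) (s : seq T) (g : T -> R) :
  \sum_(r \in [set: T]) g r * (count_mem r s)%:R = \sum_(a <- s) g a.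
Proof.
rewrite (@fsum_setT_seq _ _ (undup s)) ?undup_uniq//; last first.
  by move=> i; rewrite mem_undup => /count_memPn E; rewrite E mulr0.
rewrite -[RHS]big_undup_iterop_count; apply: eq_bigr => i _.
by rewrite mulr_natr.
Qed.

Lemma gj_solution_seq (R : realType) (f : R) (s : seq R) :
  \sum_(a <- s) a - f \is a Num.int ->
  gj_relaxation f (fun r => (count_mem r s)%:R : R^o).
Proof.
move=> sf; apply: sub_gen_smallest.
exists (fun r => count_mem r s) => //; split; last first.
  by rewrite (@sum_count_mem _ _ _ id).
apply: (@sub_finite_set _ _ [set` s]); last exact: finite_seq.
by move=> r /= /eqP; apply: contra_notT => /count_memPn.
Qed.

Lemma valid_function_seq (R : realType) (f : R) (p : R -> R) (s : seq R) :
  valid_function f p -> \sum_(a <- s) a - f \is a Num.int ->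
  1 <= \sum_(a <- s) p a.
Proof. by move=> [_ vp] /gj_solution_seq/vp; rewrite sum_count_mem. Qed.

(** The two valid functions give values at least 1 whose average is 1. *)
Lemma tight_seq (R : realType) (f : R) (p p1 p2 : R -> R) (s : seq R) :
  valid_function f p1 -> valid_function f p2 ->
  (forall r, p r = 2^-1 * (p1 r + p2 r)) ->
  \sum_(a <- s) a - f \is a Num.int -> \sum_(a <- s) p a = 1 ->
  \sum_(a <- s) p1 a = 1.
Proof.
move=> v1 v2 pE sf.
under eq_bigr do rewrite pE.
rewrite -mulr_sumr big_split /=.
have := valid_function_seq v1 sf.
have := valid_function_seq v2 sf.
lra.
Qed.

(** * A criterion for validity *)

(** With this convex set, validity needs to be tested on the generators of the
    convex hull only.  Finite support belongs to the condition because a sum over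
    an infinite support would be the default value 0. *)
Lemma convex_linear_ge1 (R : realType) (p : R -> R) :
  @convex_set R (R -> R^o)
   [set y | finite_set [set r | y r != 0] /\
            1 <= \sum_(r \in [set: R]) p r * y r].
Proof.
move=> y1 y2 l; rewrite !inE /= => -[fin1 ge1] [fin2 ge2].
have cE r : (conv l y1 y2 : R -> R^o) r =
    l%:num * y1 r + (1 - l%:num) * y2 r.
  by [].
have [s us sE] : exists2 s : seq R, uniq s &
    (forall r, r \notin s -> y1 r = 0 /\ y2 r = 0).
  exists (finmap.enum_fset
    (fset_set ([set r | y1 r != 0] `|` [set r | y2 r != 0]))).
    exact: finmap.fset_uniq.
  move=> r; rewrite in_fset_set ?finite_setU// notin_setE /= => /not_orP[].
  by move=> /negP/negPn/eqP -> /negP/negPn/eqP ->.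
split.
  apply: (@sub_finite_set _ _ [set` s]); last exact: finite_seq.
  move=> r /= /eqP; apply: contra_notT => /sE[y10 y20].
  by rewrite cE y10 y20 !mulr0 addr0.
move: ge1 ge2; rewrite !(@fsum_setT_seq _ _ s)//.
- under [X in _ -> _ -> 1 <= X]eq_bigr => r _.
    rewrite cE mulrDr !(mulrCA (p r)); over.
  rewrite big_split/= -!mulr_sumr => ge1 ge2.
  have l0 : 0 <= l%:num by [].
  have l1 : l%:num <= 1 by [].
  by nra.
- by move=> r /sE[y10 y20]; rewrite cE y10 y20 !mulr0 addr0 mulr0.
- by move=> r /sE[_ ->]; rewrite mulr0.
- by move=> r /sE[-> _]; rewrite mulr0.
Qed.

(** Subadditivity gives [1 = p (\sum_r r * y r) <= \sum_r p r * y r] for every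
    integral solution [y]. *)
Lemma subadditive_valid (R : realType) (f : R) (p : R -> R) :
  (forall r, 0 <= p r) -> p 0 = 0 ->
  (forall x y, p (x + y) <= p x + p y) ->
  (forall x, x - f \is a Num.int -> p x = 1) ->
  valid_function f p.
Proof.
move=> p_ge0 p0 pD pf; split=> // y.
move=> /(_ [set y | finite_set [set r | y r != 0] /\
            1 <= \sum_(r \in [set: R]) p r * y r]) H.
apply: (proj2 (H _)) => {H y}; split; first exact: convex_linear_ge1.
move=> _ [z [finz zf] <-] /=.
have zS r : z r != 0%N = ((z r)%:R != 0 :> R) by rewrite pnatr_eq0.
split; first by apply: sub_finite_set finz => r /=; rewrite zS.
set s := finmap.enum_fset (fset_set [set r | z r != 0%N]).
have sE r : r \notin s -> z r = 0%N.
  by rewrite in_fset_set// notin_setE /= => /negP/negPn/eqP.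
move: zf; rewrite !(@fsum_setT_seq _ _ s) ?finmap.fset_uniq//; last 2 first.
- by move=> r /sE ->; rewrite mulr0.
- by move=> r /sE ->; rewrite mulr0.
have pM r n : p (r * n%:R) <= p r * n%:R.
  elim: n => [|n IH]; first by rewrite !mulr0 p0.
  rewrite -natr1 !mulrDr !mulr1; apply: le_trans (pD _ _) _.
  by rewrite lerD2r.
move=> /pf p1; rewrite -[leLHS]p1; elim: (s) => [|r t IH].
  by rewrite !big_nil p0.
rewrite !big_cons; apply: le_trans (pD _ _) _.
exact: lerD (pM _ _) IH.
Qed.

(** * Bounded solutions of Cauchy equations *)

(** Some point of [[0, T]] carries twice the absolute value found at [x]: it is
    [2 x] when [2 x <= T], and otherwise [2 (T - x)], because [g T = 0] makes [g]
    odd about the midpoint.  Iterating, [2 ^ n * `|g x|] stays below [M]. *)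
Lemma bounded_additive_eq0 (R : realType) (T M : R) (g : R -> R) :
  (forall x, 0 <= x <= T -> `|g x| <= M) ->
  (forall x y, 0 <= x -> 0 <= y -> x + y <= T -> g (x + y) = g x + g y) ->
  g T = 0 ->
  forall x, 0 <= x <= T -> g x = 0.
Proof.
move=> gM gD gT.
have halving n x : 0 <= x <= T -> 2 ^+ n * `|g x| <= M.
  elim: n x => [|n IH] x x0T; first by rewrite mul1r gM.
  have [x' x'0T gx'] : exists2 x', 0 <= x' <= T & `|g x'| = 2 * `|g x|.
    have [x2T|Tx2] := leP (x + x) T.
      exists (x + x); first lra.
      by rewrite gD; [rewrite -mulr2n normrMn mulr_natl|lra..].
    exists ((T - x) + (T - x)); first lra.
    have : g (x + (T - x)) = g x + g (T - x) by apply: gD; lra.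
    rewrite addrC subrK gT => gx.
    have -> : g ((T - x) + (T - x)) = - (g x *+ 2).
      rewrite gD; [|lra..]; rewrite mulr2n; lra.
    by rewrite normrN normrMn mulr_natl.
  by rewrite exprSr -mulrA -gx' IH.
move=> x x0T; apply/eqP/negPn/negP => gx0.
have gx : 0 < `|g x| by rewrite normr_gt0.
have := @upper_nthrootP _ (M / `|g x|) _ (leqnn _).
by rewrite ltr_pdivrMr// ltNge halving.
Qed.

(** Subtracting the linear function with the same value at [T] reduces the claim
    to [bounded_additive_eq0]. *)
Lemma bounded_additive_linear (R : realType) (T M : R) (g : R -> R) :
  0 < T ->
  (forall x, 0 <= x <= T -> `|g x| <= M) ->
  (forall x y, 0 <= x -> 0 <= y -> x + y <= T -> g (x + y) = g x + g y) ->
  forall x, 0 <= x <= T -> g x = x * (g T / T).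
Proof.
move=> T0 gM gD x x0T; apply/eqP; rewrite -subr_eq0; apply/eqP.
apply: (@bounded_additive_eq0 _ T (M + T * `|g T / T|)
  (fun x => g x - x * (g T / T))) => //= [{x0T}x|{x x0T}x y x0 y0 xyT|].
- move=> /andP[x0 xT]; apply: le_trans (ler_normB _ _) _.
  by rewrite lerD ?gM ?x0// normrM (ger0_norm x0) ler_wpM2r.
- by rewrite gD//; ring.
- by field; rewrite gt_eqF.
Qed.

(** The Pexider equation on a triangle: its two projections are the segments
    [[beta, beta + T]] and [[2 beta, 2 beta + T]], on each of which [phi] is
    affine with the same slope.  The bound [beta <= T] is what makes the
    projections meet, and comparing the two constant terms at a common point
    leaves no room for an affine constant. *)
Lemma triangle_additive_linear (R : realType) (beta T M : R) (phi : R -> R) :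
  0 < T -> 0 <= beta <= T ->
  (forall t, 0 <= t <= T -> `|phi (beta + t)| <= M) ->
  (forall s t, 0 <= s -> 0 <= t -> s + t <= T ->
     phi (beta + s) + phi (beta + t) = phi (2 * beta + (s + t))) ->
  exists c, forall x, beta <= x <= 2 * beta + T -> phi x = c * x.
Proof.
move=> T0 beta0T phiM triangle.
have pexider (s t : R) : 0 <= s -> 0 <= t -> s + t <= T ->
    phi (beta + (s + t)) - phi beta =
    (phi (beta + s) - phi beta) + (phi (beta + t) - phi beta).
  move=> s0 t0 st; have := triangle s t s0 t0 st.
  by have := triangle 0 (s + t); rewrite addr0 add0r; lra.
have bnd (t : R) : 0 <= t <= T -> `|phi (beta + t) - phi beta| <= M + M.
  move=> tT; apply: le_trans (ler_normB _ _) _; apply: lerD; first exact: phiM.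
  by have := phiM 0; rewrite addr0; apply; lra.
have [c lin] : exists c, forall t : R, 0 <= t <= T ->
    phi (beta + t) = phi beta + t * c.
  exists ((phi (beta + T) - phi beta) / T) => t tT.
  by rewrite -(bounded_additive_linear T0 bnd pexider)// [RHS]addrC subrK.
have lin2 (t : R) : 0 <= t <= T -> phi (2 * beta + t) = 2 * phi beta + t * c.
  by move=> tT; have := triangle 0 t; rewrite addr0 add0r lin//; lra.
have phib : phi beta = beta * c.
  (* Both formulas apply at [2 * beta], the common point of the projections. *)
  have := lin beta; have := lin2 0.
  have -> : 2 * beta + 0 = beta + beta by ring.
  lra.
exists c => x bx; have [x2b|x2b] := leP x (2 * beta).
  have -> : x = beta + (x - beta) by ring.
  by rewrite lin ?phib; [ring|lra].
have -> : x = 2 * beta + (x - 2 * beta) by ring.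
by rewrite lin2 ?phib; [ring|lra].
Qed.

(** * The deviation from the middle slope *)

(** On [[0, 1[], this is [(1 + f) * p t - t] for [p] the function of the theorem
    ([drlm_deviationE]): the rescaled signed distance to the line of slope
    [1 / (1 + f)]. *)
Definition deviation (R : realType) (f b t : R) : R :=
  if t <= f then t / f
  else if t <= b then (b - t) / (b - f)
  else if t <= 1 + f - b then 0
  else (1 + f - b - t) / (b - f).

Lemma frac_decomp (R : realType) (x : R) :
  exists t, [/\ 0 <= t, t < 1 & x - t \is a Num.int].
Proof.
exists (x - (Num.floor x)%:~R).
have /andP[le_x lt_x] := floor_itv x; move: lt_x; rewrite intrD => lt_x.
by split; [lra|lra|rewrite opprB addrC subrK intr_int].
Qed.

Lemma int_bounded (R : archiRealDomainType) (x : R) (n : nat) :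
  x \is a Num.int -> -1 < x -> x < n%:R -> exists2 k, (k < n)%N & x = k%:R.
Proof.
move=> /intrP[m ->]; rewrite -[-1]/((-1)%:~R) ltr_int -[n%:R]/(n%:~R) ltr_int.
by case: m => // k _ kn; exists k.
Qed.

Section DrlmBackward.
Variables (R : realType) (f b : R).
Implicit Types t u w x y z : R.

Local Notation p := (drlm_backward_3_slope f b).
Local Notation q := (deviation f b).

Lemma breakpoint_neq0 (f0 : 0 < f) (fb : f < b) :
  [/\ f != 0, 1 + f != 0, b - f != 0 & f - b != 0].
Proof. by split; lra. Qed.

Lemma drlm_modZ x y : x - y \is a Num.int -> p x = p y.
Proof.
move=> /intrP[m xy]; have -> : x = y + m%:~R by rewrite -xy; ring.
rewrite /drlm_backward_3_slope floorDrz ?intr_int// intrD intrKfloor.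
by rewrite opprD addrACA subrr addr0.
Qed.

Lemma drlm_deviationE (f0 : 0 < f) (fb : f < b) t :
   0 <= t < 1 -> p t = (t + q t) / (1 + f).
Proof.
have [fn0 f1n0 bfn0 fbn0] := breakpoint_neq0 f0 fb.
move=> t01; rewrite /drlm_backward_3_slope /deviation.
have -> : Num.floor t = 0 by apply/eqP; rewrite floor_eq add0r.
rewrite subr0; case: ifP => _; last case: ifP => _; last case: ifP => _.
- by field; rewrite fn0 f1n0.
- by field; rewrite bfn0 fbn0 f1n0.
- by rewrite addr0.
- by field; rewrite bfn0 fbn0 f1n0.
Qed.

Lemma deviation_lowE t : t <= f -> q t = t / f.
Proof. by rewrite /deviation => ->. Qed.

Lemma deviation_highE (f0 : 0 < f) (fb : f < b) (b4 : b <= (1 + f) / 4) t :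
   1 + f - b <= t -> q t = (1 + f - b - t) / (b - f).
Proof.
move=> bt; rewrite /deviation ifF; last lra; rewrite ifF; last lra.
case: ifP => // tb; have -> : t = 1 + f - b by lra.
by rewrite subrr mul0r.
Qed.

Lemma deviation_ge0 (f0 : 0 < f) (fb : f < b) t :
   0 <= t -> t <= 1 + f - b -> 0 <= q t.
Proof.
move=> t0 tb; rewrite /deviation; case: ifP => [_|_]; first exact: divr_ge0 (ltW _).
case: ifP => [tb'|_]; first by rewrite divr_ge0 ?subr_ge0 // ltW.
by rewrite tb.
Qed.

Lemma deviation_geN1 (f0 : 0 < f) (fb : f < b) (b4 : b <= (1 + f) / 4) t :
   0 <= t -> t < 1 -> -1 <= q t.
Proof.
move=> t0 t1; have [tb|bt] := leP t (1 + f - b).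
  by apply: le_trans (deviation_ge0 f0 fb t0 tb); lra.
by rewrite (deviation_highE f0 fb b4) ?ler_pdivlMr; lra.
Qed.

(** The second piece of [deviation], prolonged as a line, stays below it beyond
    [f]. *)
Lemma deviation_ge_descent (f0 : 0 < f) (fb : f < b) (b4 : b <= (1 + f) / 4) t :
   f < t -> (b - t) / (b - f) <= q t.
Proof.
have bf0 : 0 <= (b - f)^-1 by rewrite invr_ge0; lra.
move=> ft; rewrite /deviation ifF; last lra.
case: ifP => // bt; case: ifP => _; last by rewrite ler_wpM2r//; lra.
by rewrite mulr_le0_ge0//; lra.
Qed.

(** The reflection exchanges the descent on [[f, b]] with the final descent. *)
Lemma deviation_antisym (f0 : 0 < f) (fb : f < b) (b4 : b <= (1 + f) / 4) t u :
  t < 1 -> u < 1 -> t + u = 1 + f -> q t + q u = 0.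
Proof.
move=> t1 u1 tu.
have descend x y : f < x -> x <= b -> x + y = 1 + f -> q x + q y = 0.
  move=> fx xb xy; rewrite (@deviation_highE f0 fb b4 y); last lra.
  rewrite /deviation ifF; last lra.
  rewrite xb -mulrDl; have -> : b - x + (1 + f - b - y) = 0 by lra.
  by rewrite mul0r.
have [tb|bt] := leP t b; first by apply: descend; lra.
have [ub|bu] := leP u b; first by rewrite addrC; apply: descend; lra.
have mid x : b < x -> x <= 1 + f - b -> q x = 0.
  move=> bx xb; rewrite /deviation ifF; last lra.
  by rewrite ifF ?xb//; lra.
by rewrite !mid ?addr0; lra.
Qed.

(** The loss at [w] forces [t + u <= b].  If [t] and [u] lie on the initial
    ascent, they contribute [(t + u) / f >= 1]; if one lies beyond [f], its
    descent has the slope of the one at [w] and compensates it. *)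
Lemma deviation_sum1 (f0 : 0 < f) (fb : f < b) (b4 : b <= (1 + f) / 4) t u w :
   0 <= t -> 0 <= u -> w < 1 ->
  1 + f - b <= w -> t + u + w = 1 + f -> 0 <= q t + q u + q w.
Proof.
move=> t0 u0 w1 bw tuw.
have qw : q w = (t + u - b) / (b - f).
  by rewrite (deviation_highE f0 fb b4)//; congr (_ / _); lra.
have bf0 : 0 <= (b - f)^-1 by rewrite invr_ge0; lra.
have descend x y : f < x -> 0 <= y -> x + y + w = 1 + f ->
    0 <= q x + q y + (x + y - b) / (b - f).
  move=> fx y0 xyw; have := deviation_ge_descent f0 fb b4 fx.
  have : 0 <= q y by apply: (deviation_ge0 f0 fb); lra.
  have : 0 <= y / (b - f) by rewrite mulr_ge0.
  have -> : (x + y - b) / (b - f) = y / (b - f) - (b - x) / (b - f).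
    by rewrite -mulrBl; congr (_ / _); ring.
  lra.
have [ft|tf] := ltP f t; first by rewrite qw descend.
have [fu|uf] := ltP f u; first by rewrite qw (addrC (q t)) (addrC t) descend//; lra.
have := deviation_geN1 f0 fb b4 (le_trans _ bw) w1.
rewrite (deviation_lowE tf) (deviation_lowE uf) -mulrDl.
have : 1 <= (t + u) / f by rewrite ler_pdivlMr//; lra.
by move=> H1 H2; have := H2 ltac:(lra); lra.
Qed.

(** The values at [t] and [u] and the descent line at [w] share one slope, so
    their sum depends on [t + u + w] only: it is -1. *)
Lemma deviation_sum2 (f0 : 0 < f) (fb : f < b) (b4 : b <= (1 + f) / 4) t u w :
   1 + f - b <= t < 1 -> 1 + f - b <= u < 1 ->
  t + u + w = 2 + f -> -1 <= q t + q u + q w.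
Proof.
have [fn0 f1n0 bfn0 fbn0] := breakpoint_neq0 f0 fb.
move=> /andP[bt t1] /andP[bu u1] tuw.
rewrite (deviation_highE f0 fb b4 bt) (deviation_highE f0 fb b4 bu).
have fw : f < w by lra.
have := deviation_ge_descent f0 fb b4 fw.
have -> : (b - w) / (b - f) =
   -1 - (1 + f - b - t) / (b - f) - (1 + f - b - u) / (b - f).
  have -> : w = 2 + f - t - u by lra.
  by field.
lra.
Qed.

(** * Subadditivity and symmetry *)

Lemma drlm_triple (f0 : 0 < f) (fb : f < b) (b4 : b <= (1 + f) / 4) x y z :
   x + y + z - f \is a Num.int -> 1 <= p x + p y + p z.
Proof.
have [fn0 f1n0 bfn0 fbn0] := breakpoint_neq0 f0 fb.
have [t [t0 t1 xt]] := frac_decomp x.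
have [u [u0 u1 yu]] := frac_decomp y.
have [w [w0 w1 zw]] := frac_decomp z.
move=> xyzf; rewrite (drlm_modZ xt) (drlm_modZ yu) (drlm_modZ zw).
rewrite !(drlm_deviationE f0 fb) ?t0 ?u0 ?w0// -!mulrDl ler_pdivlMr; last lra.
have tuwf : t + u + w - f \is a Num.int.
  have -> : t + u + w - f = (x + y + z - f) - (x - t) - (y - u) - (z - w) by ring.
  exact: rpredB (rpredB (rpredB xyzf xt) yu) zw.
have [||k k3 tuwk] := int_bounded (n := 3) tuwf; [lra..|].
have qt := deviation_geN1 f0 fb b4 t0 t1.
have qu := deviation_geN1 f0 fb b4 u0 u1.
have qw := deviation_geN1 f0 fb b4 w0 w1.
have qt0 := deviation_ge0 f0 fb t0.
have qu0 := deviation_ge0 f0 fb u0.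
have qw0 := deviation_ge0 f0 fb w0.
case: k k3 tuwk => [|[|[|//]]] _ /= tuw.
- rewrite !deviation_lowE; [|lra..].
  have : t / f + u / f + w / f = 1.
    have tuwE : t + u + w = f by lra.
    by rewrite -!mulrDl tuwE divff.
  lra.
- have [bw|wb] := leP (1 + f - b) w.
    by have := @deviation_sum1 f0 fb b4 t u w; lra.
  have [bu|ub] := leP (1 + f - b) u.
    by have := @deviation_sum1 f0 fb b4 t w u; lra.
  have [bt|tb] := leP (1 + f - b) t.
    by have := @deviation_sum1 f0 fb b4 u w t; lra.
  lra.
- have [bw|wb] := leP (1 + f - b) w.
    have [bu|ub] := leP (1 + f - b) u.
      by have := @deviation_sum2 f0 fb b4 u w t; lra.
    have [bt|tb] := leP (1 + f - b) t.
      by have := @deviation_sum2 f0 fb b4 t w u; lra.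
    lra.
  have [bu|ub] := leP (1 + f - b) u.
    have [bt|tb] := leP (1 + f - b) t.
      by have := @deviation_sum2 f0 fb b4 t u w; lra.
    lra.
  lra.
Qed.

Lemma drlm_sym (f0 : 0 < f) (fb : f < b) (b4 : b <= (1 + f) / 4) x y :
   x + y - f \is a Num.int -> p x + p y = 1.
Proof.
have [fn0 f1n0 bfn0 fbn0] := breakpoint_neq0 f0 fb.
have [t [t0 t1 xt]] := frac_decomp x.
have [u [u0 u1 yu]] := frac_decomp y.
move=> xyf; rewrite (drlm_modZ xt) (drlm_modZ yu).
rewrite !(drlm_deviationE f0 fb) ?t0 ?u0// -!mulrDl.
have tuf : t + u - f \is a Num.int.
  have -> : t + u - f = (x + y - f) - (x - t) - (y - u) by ring.
  exact: rpredB (rpredB xyf xt) yu.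
have [||k k3 tuk] := int_bounded (n := 2) tuf; [lra..|].
case: k k3 tuk => [|[|//]] _ /= tu.
- have -> : u = f - t by lra.
  by rewrite !deviation_lowE; [field; rewrite f1n0 fn0|lra..].
- have tu1 : t + u = 1 + f by lra.
  by rewrite addrACA (deviation_antisym f0 fb b4 t1 u1 tu1) tu1 addr0 divff.
Qed.

Lemma drlm_ge0 (f0 : 0 < f) (fb : f < b) (b4 : b <= (1 + f) / 4) x :
   0 <= p x.
Proof.
have [fn0 f1n0 bfn0 fbn0] := breakpoint_neq0 f0 fb.
have [t [t0 t1 xt]] := frac_decomp x; rewrite (drlm_modZ xt).
rewrite (drlm_deviationE f0 fb) ?t0// divr_ge0//; last lra.
have [tb|bt] := leP t (1 + f - b); first by have := deviation_ge0 f0 fb t0 tb; lra.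
rewrite (deviation_highE f0 fb b4); last lra.
have -> : 1 + f - b - t = (1 - t) - (b - f) by ring.
rewrite mulrBl divff//.
have : 1 - t <= (1 - t) / (b - f) by rewrite ler_pdivlMr ?ler_piMr; lra.
lra.
Qed.

End DrlmBackward.

Lemma drlm_valid (R : realType) (f b : R) :
  0 < f -> f < b -> b <= (1 + f) / 4 ->
  valid_function f (drlm_backward_3_slope f b).
Proof.
move=> f0 fb b4.
have p0 : drlm_backward_3_slope f b 0 = 0.
  have [|low _ _ _] := @drlm_backward_3_slopeE _ _ _ 0 f0 fb b4; first lra.
  by rewrite low ?mul0r// ltW.
apply: subadditive_valid => // [|x y|x xf]; first exact: drlm_ge0.
- have := @drlm_triple _ _ _ f0 fb b4 x y (f - (x + y)).
  have := @drlm_sym _ _ _ f0 fb b4 (x + y) (f - (x + y)).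
  rewrite (addrC (x + y)) subrK subrr => sym triple.
  by have := sym (rpred0 _); have := triple (rpred0 _); lra.
- have := @drlm_sym _ _ _ f0 fb b4 x 0.
  by rewrite addr0 p0 addr0; exact.
Qed.

(** * Rigidity and extremality *)

(** Tight solutions with at most three entries suffice.  The pieces depend on one
    another: the first and the third have their slopes fixed by [phi f = 1] and by
    the symmetry, the last takes its slope from its common endpoint with the
    third, and the second is the mirror image of the last. *)
Lemma drlm_rigid (R : realType) (f b : R) (phi : R -> R) :
  0 < f -> f < b -> b <= (1 + f) / 4 ->
  (forall x, 0 <= phi x) ->
  (forall s, \sum_(a <- s) a - f \is a Num.int ->
     \sum_(a <- s) drlm_backward_3_slope f b a = 1 ->
     \sum_(a <- s) phi a = 1) ->
  forall x, phi x = drlm_backward_3_slope f b x.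
Proof.
move=> f0 fb b4 phi_ge0 tight.
set p := drlm_backward_3_slope f b in tight *.
have [fn0 f1n0 bfn0 fbn0] := breakpoint_neq0 f0 fb.
have psym x y : x + y - f \is a Num.int -> p x + p y = 1 :=
  @drlm_sym _ _ _ f0 fb b4 x y.
have pE (x : R) : 0 <= x <= 1 -> _ := @drlm_backward_3_slopeE _ _ _ x f0 fb b4.
have p_low (x : R) : 0 <= x -> x <= f -> p x = x / f.
  by move=> x0 xf; have [|low _ _ _] := pE x; [lra|exact: low].
have p_mid (x : R) : b <= x -> x <= 1 + f - b -> p x = x / (1 + f).
  by move=> bx xb; have [|_ _ mid _] := pE x; [lra|apply: mid; lra].
have p_high (u : R) : 0 <= u -> u <= b - f ->
    p (1 - u) = u * ((1 + f - b) / ((1 + f) * (b - f))).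
  move=> u0 ub; have [|_ _ _ high] := pE (1 - u); first lra.
  rewrite /p high; last lra.
  by field; rewrite f1n0 bfn0.
have sym x y : x + y - f \is a Num.int -> phi x + phi y = 1.
  move=> xyf; have := tight [:: x; y]; rewrite !big_cons !big_nil !addr0.
  by move=> /(_ xyf (psym _ _ xyf)).
have phi_le1 x : phi x <= 1.
  have := sym x (f - x); rewrite [x + _]addrC subrK subrr => /(_ (rpred0 _)).
  by have := phi_ge0 (f - x); lra.
have phi_modZ x y : x - y \is a Num.int -> phi x = phi y.
  move=> xy; have := sym x (f - x); have := sym y (f - x).
  rewrite [x + _]addrC subrK subrr => H /(_ (rpred0 _)).
  have : phi y + phi (f - x) = 1.
    apply: H; have -> : y + (f - x) - f = - (x - y) by ring.
    by rewrite rpredN.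
  lra.
have phi_add x y : p (x + y) = p x + p y -> phi (x + y) = phi x + phi y.
  move=> pxy.
  (* Close the relation into a tight solution with the complement of [x + y]. *)
  have xyf : x + y + (f - (x + y)) - f \is a Num.int.
    by rewrite [_ + (f - _)]addrC subrK subrr rpred0.
  have := tight [:: x; y; f - (x + y)]; rewrite !big_cons !big_nil !addr0.
  rewrite (addrA x) (addrA (p x)) -pxy => /(_ xyf (psym _ _ xyf)).
  by have := sym _ _ xyf; lra.
have phif : phi f = 1.
  have := tight [:: f]; rewrite !big_seq1 subrr; apply => //.
  by rewrite p_low ?divff// ltW.
have low (x : R) : 0 <= x <= f -> phi x = p x.
  move=> x0f; have /andP[x0 xf] := x0f.
  rewrite p_low// (@bounded_additive_linear _ f 1 phi f0 _ _ x x0f) ?phif ?mul1r//.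
    by move=> y _; rewrite ger0_norm.
  by move=> y z y0 z0 yzf; apply: phi_add; rewrite !p_low ?mulrDl//; lra.
have mid (x : R) : b <= x <= 1 + f - b -> phi x = p x.
  move=> /andP[bx xb].
  have T0 : 0 < 1 + f - 3 * b by lra.
  have [|||c lin] := @triangle_additive_linear _ b _ 1 phi T0.
  - lra.
  - by move=> y _; rewrite ger0_norm.
  - move=> s t s0 t0 st.
    have -> : 2 * b + (s + t) = (b + s) + (b + t) by ring.
    by symmetry; apply: phi_add; rewrite !p_mid ?mulrDl//; lra.
  (* The midpoint of the middle segment is its own mirror image. *)
  have half : phi ((1 + f) / 2) + phi ((1 + f) / 2) = 1.
    apply: sym; have -> : (1 + f) / 2 + (1 + f) / 2 - f = 1 by field.
    exact: rpred1.
  rewrite p_mid// lin; last lra.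
  rewrite lin in half; last lra.
  by apply: (mulIf f1n0); rewrite divfK//; nra.
(* Near 1, work with the distance [u] to 1; the slope comes from the value at
   [1 + f - b], an endpoint of the middle segment. *)
have high (x : R) : 1 + f - b <= x <= 1 -> phi x = p x.
  move=> /andP[bx x1]; have -> : x = 1 - (1 - x) by ring.
  have u0 : 0 <= 1 - x <= b - f by lra.
  have bf0 : 0 < b - f by lra.
  rewrite (@bounded_additive_linear _ (b - f) 1 (fun u => phi (1 - u)) bf0 _ _ _ u0).
  - rewrite mid; last lra.
    by rewrite !p_high; [field; rewrite f1n0 bfn0|lra..].
  - by move=> y _; rewrite ger0_norm.
  - move=> y z y0 z0 yz.
    have modZ : (1 - y) + (1 - z) - (1 - (y + z)) \is a Num.int.
      have -> : (1 - y) + (1 - z) - (1 - (y + z)) = 1 by ring.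
      exact: rpred1.
    rewrite -(phi_modZ _ _ modZ); apply: phi_add.
    by rewrite /p (drlm_modZ _ _ modZ) -/p !p_high ?mulrDl//; lra.
have descent (x : R) : f <= x <= b -> phi x = p x.
  move=> fxb.
  have xsym : x + (1 + f - x) - f \is a Num.int.
    have -> : x + (1 + f - x) - f = 1 by ring.
    exact: rpred1.
  have := sym _ _ xsym; have := psym _ _ xsym.
  by rewrite (high (1 + f - x)); lra.
move=> x; have [t [t0 t1 xt]] := frac_decomp x.
rewrite (phi_modZ _ _ xt) /p (drlm_modZ _ _ xt) -/p.
have [tf|ft] := leP t f; first by apply: low; lra.
have [tb|bt] := leP t b; first by apply: descent; lra.
have [tb'|bt'] := leP t (1 + f - b); first by apply: mid; lra.
by apply: high; lra.
Qed.

Theorem theorem4p1 (R : realType) (f b : R) :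
  0 < f -> f < b -> b <= (1 + f) / 4 ->
  extreme_function f (drlm_backward_3_slope f b).
Proof.
move=> f0 fb b4; split; first exact: drlm_valid.
move=> p1 p2 v1 v2 pE; split; apply/esym/funext; apply: drlm_rigid => //.
- by case: v1.
- by move=> s; exact: (tight_seq v1 v2 pE).
- by case: v2.
- by move=> s; apply: (tight_seq v2 v1) => r; rewrite addrC.
Qed.
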